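(* Let $\mathbf F$ be a Fraïssé structure. The following are equivalent: (i) Every zero-dimensional proximal $\mathrm{Aut}(\mathbf F)$-flow has a fixed point. (ii) $\mathbf F$ has the proximal Ramsey property. When the finite proximal colorings are uniformly dense in the set of all proximal functions on $\mathrm{Aut}(\mathbf F)$, these statements are equivalent to $\mathrm{Aut}(\mathbf F)$ being strongly amenable.
   Context: Structures. Languages are first-order and relational; a structure is a non-empty set with interpretations of the relation symbols. An embedding is an isomorphism onto its image; $\binom{\mathbf B}{\mathbf A}$ denotes the set of all embeddings of $\mathbf A$ into $\mathbf B$. A Fraïssé structure is a countable ultrahomogeneous structure (every isomorphism between finite substructures extends to an automorphism). $\mathrm{Age}(\mathbf F)$ is the set of all finite substructures of $\mathbf F$. $G=\mathrm{Aut}(\mathbf F)$ is a topological group for which the pointwise stabilizers of finite substructures form a basis of neighborhoods of the identity. Flows. A $G$-flow is a continuous left action on a non-empty compact Hausdorff space $X$. It is proximal when for all $x,y\in X$ and every entourage $U$ of the uniformity of $X$ there is $g\in G$ with $(g\cdot x,g\cdot y)\in U$. It is zero-dimensional when $X$ is. $G$ is strongly amenable when every proximal $G$-flow has a fixed point. Colorings. A coloring of $\binom{\mathbf F}{\mathbf A}$ is a map $\chi:\binom{\mathbf F}{\mathbf A}\to\mathbb C$; it is finite when its range is finite. A coloring $\chi$ of $\binom{\mathbf F}{\mathbf A}$ ($\mathbf A\in\mathrm{Age}(\mathbf F)$) is proximal when for every $\mathbf D\in\mathrm{Age}(\mathbf F)$ there is $\mathbf E\in\mathrm{Age}(\mathbf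 F)$ such that for all $e_1,e_2\in\binom{\mathbf F}{\mathbf E}$ there is $d\in\binom{\mathbf E}{\mathbf D}$ such that the colorings $a\mapsto\chi(e_1\circ a)$ and $a\mapsto\chi(e_2\circ a)$ agree on $\binom{d(\mathbf D)}{\mathbf A}$. $\mathbf F$ has the proximal Ramsey property when for all $\mathbf A,\mathbf B\in\mathrm{Age}(\mathbf F)$ and every finite proximal coloring $\chi$ of $\binom{\mathbf F}{\mathbf A}$ there is $b\in\binom{\mathbf F}{\mathbf B}$ such that $\chi$ is constant on $\binom{b(\mathbf B)}{\mathbf A}$. Functions. $\mathrm{RUC}_b(G)$ is the C$^*$-algebra (supremum norm) of bounded right-uniformly continuous functions $f:G\to\mathbb C$: for every $\varepsilon>0$ there is a neighborhood $U$ of the identity such that $gh^{-1}\in U$ implies $|f(g)-f(h)|<\varepsilon$. Put $(g\bullet f)(h)=f(hg)$; the closure $\overline{G\bullet f}$ of the orbit in the topology of pointwise convergence is a $G$-flow. A function $f\in\mathrm{RUC}_b(G)$ is proximal when the flow $G\curvearrowright\overline{G\bullet f}$ is proximal. A finite coloring $\chi$ of $\binom{\mathbf F}{\mathbf A}$, $\mathbf A$ a finite substructure of $\mathbf F$, is identified with the function $g\mapsto\chi(g^{-1}\upharpoonright A)$ in $\mathrm{RUC}_b(G)$. ''Uniformly dense'' means dense for the supremum norm. *)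

(* Defs.v *)
From HB Require Import structures.
From mathcomp Require Import all_boot all_order all_algebra.
From mathcomp Require Import complex.
From mathcomp Require Import all_classical all_reals all_analysis.

Set Implicit Arguments.
Unset Strict Implicit.
Unset Printing Implicit Defensive.

Import Order.TTheory GRing.Theory Num.Theory.
Import numFieldNormedType.Exports.

Local Open Scope classical_set_scope.
Local Open Scope ring_scope.

Record language := Language { symb : Type; arity : symb -> nat }.

Record structure (L : language) := Structure {
  carrier :> Type;
  rel_of : forall r : symb L, (arity r).-tuple carrier -> Prop;
  structure_nonempty : [set: carrier] !=set0 }.

Section Embeddings.
Variable L : language.
Implicit Types M N P : structure L.

Record embedding M N := Embedding {
  emb_fun :> M -> N;
  emb_inj : injective emb_fun;
  emb_rel : forall (r : symb L) (t : (arity r).-tuple M),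
    rel_of (map_tuple emb_fun t) <-> rel_of t }.

Lemma embP M N (e1 e2 : embedding M N) : e1 =1 e2 -> e1 = e2.
Proof.
case: e1 => f1 i1 r1; case: e2 => f2 i2 r2 /= /funext e; subst f2.
by congr Embedding; exact: Prop_irrelevance.
Qed.

Program Definition emb_id M : embedding M M := @Embedding M M id _ _.
Next Obligation. by move=> M x y. Qed.
Next Obligation.
move=> M r t; rewrite (_ : map_tuple _ t = t)//.
by apply: val_inj; rewrite /= map_id.
Qed.

Program Definition emb_comp M N P (e : embedding N P) (d : embedding M N) :
  embedding M P := @Embedding M P (e \o d) _ _.
Next Obligation.
by move=> M N P e d; exact: inj_comp (@emb_inj _ _ e) (@emb_inj _ _ d).
Qed.
Next Obligation.
move=> M N P e d r t.
have -> : map_tuple (e \o d) t = map_tuple e (map_tuple d t).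
  by apply: val_inj; rewrite /= map_comp.
by split => [/emb_rel/emb_rel //|h]; apply/emb_rel/emb_rel.
Qed.

Section Substructure.
Variables (M : structure L) (S : set M) (S0 : S !=set0).

Lemma set_type_nonempty : [set: set_type S] !=set0.
Proof. by case: S0 => x Sx; exists (exist _ x (mem_set Sx)). Qed.

Definition substructure : structure L :=
  @Structure L (set_type S) (fun r t => rel_of (map_tuple set_val t))
    set_type_nonempty.

Definition incl : embedding substructure M :=
  @Embedding substructure M set_val val_inj (fun r t => iff_refl _).

End Substructure.

Lemma range_nonempty M N (e : embedding M N) : range e !=set0.
Proof. by have [x _] := structure_nonempty M; exists (e x), x. Qed.

(* The image e(M), as a substructure of N. *)
Definition copy M N (e : embedding M N) : structure L :=
  substructure (range_nonempty e).

Definition copy_incl M N (e : embedding M N) : embedding (copy e) N :=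
  incl (range_nonempty e).

Record age (F : structure L) := Age {
  age_set : set F;
  age_finite : finite_set age_set;
  age_nonempty : age_set !=set0 }.

Definition age_structure (F : structure L) (A : age F) : structure L :=
  substructure (age_nonempty A).
Coercion age_structure : age >-> structure.

Definition age_incl (F : structure L) (A : age F) : embedding A F :=
  incl (age_nonempty A).

End Embeddings.

Arguments emb_id {L} M.

(* The inverse map is carried as data; it is determined by the map itself. *)
Record Aut (L : language) (F : structure L) := MkAut {
  aut_emb :> embedding F F;
  aut_inv : F -> F;
  autK : cancel aut_emb aut_inv;
  autVK : cancel aut_inv aut_emb }.

Section AutGroup.
Variables (L : language) (F : structure L).
Implicit Types g h : Aut F.

Lemma autP g h : g =1 h -> g = h.
Proof.
case: g => g g' gK gVK; case: h => h h' hK hVK /= e.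
have ? : g = h by exact: embP.
subst h.
have ? : g' = h'.
  by apply/funext => x; apply: (can_inj gK); rewrite gVK hVK.
by subst h'; congr MkAut; exact: Prop_irrelevance.
Qed.

Definition aut_one : Aut F := @MkAut L F (emb_id F) id (frefl _) (frefl _).

Definition aut_mul g h : Aut F :=
  @MkAut L F (emb_comp g h) (aut_inv h \o aut_inv g)
    (can_comp (@autK _ _ g) (@autK _ _ h))
    (can_comp (@autVK _ _ h) (@autVK _ _ g)).

Lemma aut_inv_rel g (r : symb L) (t : (arity r).-tuple F) :
  rel_of (map_tuple (aut_inv g) t) <-> rel_of t.
Proof.
rewrite -(emb_rel g) (_ : map_tuple g _ = t)//.
by apply: val_inj; rewrite /= -map_comp (eq_map (@autVK _ _ g)) map_id.
Qed.

Definition aut_invg g : Aut F :=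
  @MkAut L F (Embedding (can_inj (@autVK _ _ g)) (@aut_inv_rel g)) g
    (@autVK _ _ g) (@autK _ _ g).

HB.instance Definition _ := gen_eqMixin (Aut F).
HB.instance Definition _ := gen_choiceMixin (Aut F).

Fact aut_mulA : associative aut_mul. Proof. by move=> a b c; exact: autP. Qed.
Fact aut_mul1g : left_id aut_one aut_mul. Proof. by move=> a; exact: autP. Qed.
Fact aut_mulg1 : right_id aut_one aut_mul. Proof. by move=> a; exact: autP. Qed.
Fact aut_mulVg : left_inverse aut_one aut_invg aut_mul.
Proof. by move=> a; apply: autP => x /=; rewrite autK. Qed.
Fact aut_mulgV : right_inverse aut_one aut_invg aut_mul.
Proof. by move=> a; apply: autP => x /=; rewrite autVK. Qed.

HB.instance Definition _ := isGroup.Build (Aut F)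
  aut_mulA aut_mul1g aut_mulg1 aut_mulVg aut_mulgV.

(* The cosets g Stab(A), A finite, form a basis of neighborhoods of g. *)
Definition aut_nbhs g : set_system (Aut F) :=
  filter_from (@finite_set F) (fun A => [set h : Aut F | {in A, h =1 g}]).

HB.instance Definition _ := hasNbhs.Build (Aut F) aut_nbhs.

Fact aut_nbhs_filter g : ProperFilter (nbhs g).
Proof.
apply: filter_from_proper; last by move=> A _; exists g.
apply: filter_from_filter; first by exists set0.
move=> A B fA fB; exists (A `|` B); first by rewrite finite_setU.
by move=> h /= e; split=> x xA; apply: e; rewrite inE; [left|right]; exact: set_mem.
Qed.

Fact aut_nbhs_singleton g (U : set (Aut F)) : nbhs g U -> U g.
Proof. by case=> A fA; apply. Qed.

Fact aut_nbhs_nbhs g (U : set (Aut F)) : nbhs g U -> nbhs g (nbhs^~ U).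
Proof.
case=> A fA AU; exists A => // h hg; exists A => // k kh.
by apply: AU => x xA; rewrite kh// hg.
Qed.

HB.instance Definition _ := Nbhs_isNbhsTopological.Build (Aut F)
  aut_nbhs_filter aut_nbhs_singleton aut_nbhs_nbhs.

End AutGroup.

HB.structure Definition PreTopologicalGroup := {G of Group G & Topological G}.

HB.mixin Record isTopologicalGroup G & PreTopologicalGroup G := {
  mulg_continuous : continuous (fun p : G * G => p.1 * p.2)%g;
  invg_continuous : continuous (fun g : G => g^-1)%g }.

#[short(type="topologicalGroupType")]
HB.structure Definition TopologicalGroup :=
  {G of isTopologicalGroup G & PreTopologicalGroup G}.

Section AutTopologicalGroup.
Variables (L : language) (F : structure L).

Fact aut_mul_continuous : continuous (fun p : Aut F * Aut F => p.1 * p.2)%g.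
Proof.
move=> [g h] U [A fA AU].
exists ([set g' : Aut F | {in h @` A, g' =1 g}],
        [set h' : Aut F | {in A, h' =1 h}]).
  by split; [exists (h @` A) => //; exact: finite_image|exists A].
move=> [g' h'] [/= eg eh]; apply: AU => x xA /=.
by rewrite eh// eg// inE; exists x => //; exact: set_mem.
Qed.

Fact aut_inv_continuous : continuous (fun g : Aut F => g^-1)%g.
Proof.
move=> g U [A fA AU]; exists (aut_inv g @` A); first exact: finite_image.
move=> h eh; apply: AU => x xA /=; apply: (can_inj (@autK _ _ h)).
by rewrite autVK eh ?autVK// inE; exists x => //; exact: set_mem.
Qed.

HB.instance Definition _ := isTopologicalGroup.Build (Aut F)
  aut_mul_continuous aut_inv_continuous.

End AutTopologicalGroup.

Definition ultrahomogeneous (L : language) (F : structure L) :=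
  forall (A B : age F) (i : embedding A B), bijective i ->
  exists g : Aut F, forall a : A, g (age_incl A a) = age_incl B (i a).

Definition fraisse_structure (L : language) (F : structure L) :=
  countable [set: F] /\ ultrahomogeneous F.

(* A compact Hausdorff space carries exactly one uniformity compatible with its
   topology, so the compact Hausdorff uniformTypes are the compact Hausdorff
   spaces together with "the" uniformity. *)
Record flow (G : topologicalGroupType) := Flow {
  flow_space :> uniformType;
  flow_act : G -> flow_space -> flow_space;
  flow_nonempty : [set: flow_space] !=set0;
  flow_compact : compact [set: flow_space];
  flow_hausdorff : hausdorff_space flow_space;
  flow_act1 : forall x, flow_act 1%g x = x;
  flow_actM : forall g h x, flow_act (g * h)%g x = flow_act g (flow_act h x);
  flow_continuous :
    continuous (fun p : G * flow_space => flow_act p.1 p.2) }.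

Definition proximal_action (G : Type) (X : uniformType) (act : G -> X -> X) :=
  forall (x y : X) (U : set (X * X)), entourage U ->
  exists g, U (act g x, act g y).

Definition proximal_flow (G : topologicalGroupType) (X : flow G) :=
  proximal_action (@flow_act G X).

(* The library's zero_dimensional only asks that points be separated by clopen
   sets; here the clopen sets must form a basis of the topology. *)
Definition zero_dimensional_flow (G : topologicalGroupType) (X : flow G) :=
  basis (@clopen X).

Definition has_fixed_point (G : topologicalGroupType) (X : flow G) :=
  exists x : X, forall g, flow_act g x = x.

Definition strongly_amenable (G : topologicalGroupType) :=
  forall X : flow G, proximal_flow X -> has_fixed_point X.

Definition zero_dimensional_strongly_amenable (G : topologicalGroupType) :=
  forall X : flow G,
    zero_dimensional_flow X -> proximal_flow X -> has_fixed_point X.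

(* The ascription as a numClosedFieldType gives access to the topology and the
   uniformity induced by the modulus. *)
Definition Complex (R : realType) : numClosedFieldType := R[i].

Section Colorings.
Variables (R : realType) (L : language) (F : structure L).
Local Notation C := (Complex R).

Definition coloring (A : age F) := embedding A F -> C.

Definition finite_coloring (A : age F) (chi : coloring A) :=
  finite_set (range chi).

Definition proximal_coloring (A : age F) (chi : coloring A) :=
  forall D : age F, exists E : age F, forall e1 e2 : embedding E F,
  exists d : embedding D E, forall a : embedding A (copy d),
    chi (emb_comp e1 (emb_comp (copy_incl d) a)) =
    chi (emb_comp e2 (emb_comp (copy_incl d) a)).

Definition proximal_ramsey_property :=
  forall (A B : age F) (chi : coloring A),
    finite_coloring chi -> proximal_coloring chi ->
  exists b : embedding B F, forall a1 a2 : embedding A (copy b),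
    chi (emb_comp (copy_incl b) a1) = chi (emb_comp (copy_incl b) a2).

Definition coloring_fun (A : age F) (chi : coloring A) : Aut F -> C :=
  fun g => chi (emb_comp (g^-1)%g (age_incl A)).

End Colorings.

Section ProximalFunctions.
Variables (R : realType) (G : topologicalGroupType).
Local Notation C := (Complex R).
Implicit Types (f : G -> C) (g h : G).

(* Inequalities between complex numbers only hold when their difference is
   real: [M] and [eps] below range over the nonnegative, resp. positive, reals. *)
Definition RUCb f :=
  (exists M : C, forall g, `|f g| <= M) /\
  (forall eps : C, 0 < eps ->
   exists2 U : set G, nbhs (1%g : G) U &
     forall g h, U (g * h^-1)%g -> `|f g - f h| < eps).

Definition translate g f : G -> C := fun h => f (h * g)%g.

Definition orbit_closure f : set {ptws G -> C} :=
  closure [set (translate g f : {ptws G -> C}) | g in [set: G]].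

Lemma translateM g h f : translate g (translate h f) = translate (g * h)%g f.
Proof. by apply/funext => k; rewrite /translate mulgA. Qed.

Lemma translate_continuous g :
  continuous (translate g : {ptws G -> C} -> {ptws G -> C}).
Proof.
move=> u; have nF : Filter (nbhs u) by exact: nbhs_filter.
have [_ cvgu] := @cvg_sup _ _ (fun h => Topological.class
    (initial_topology (fun f : G -> C => f h))) _ (translate g u)
  (fmap_filter (translate g) nF).
apply: cvgu => h A [_ [[B oB <-] Bu] BA].
have := @proj_continuous G (fun _ => C) (h * g)%g u B
  (open_nbhs_nbhs (conj oB Bu)).
by move=> nB; apply: (@filterS _ _ nF _ _ _ nB) => f Bf; exact: BA.
Qed.

Lemma translate_orbit_closure f g (u : {ptws G -> C}) :
  orbit_closure f u -> orbit_closure f (translate g u).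
Proof.
move=> fu V /translate_continuous /fu [_ [[h _ <-] Vh]].
by exists (translate (g * h)%g f); split; [exists (g * h)%g|rewrite -translateM].
Qed.

Definition orbit_closure_act f g (u : orbit_closure f) : orbit_closure f :=
  exist _ (translate g (val u))
    (mem_set (@translate_orbit_closure f g _ (set_mem (valP u)))).

Definition proximal_function f :=
  RUCb f /\ proximal_action (@orbit_closure_act f).

End ProximalFunctions.

Definition proximal_colorings_dense (R : realType) (L : language)
    (F : structure L) :=
  forall f : Aut F -> Complex R, proximal_function f ->
  forall eps : Complex R, 0 < eps ->
  exists (A : age F) (chi : coloring R A),
    [/\ finite_coloring chi, proximal_coloring chi &
        forall g : Aut F, `|f g - coloring_fun chi g| < eps].

(* Main.v *)
From mathcomp Require Import all_boot all_order all_algebra.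
From mathcomp Require Import complex.
From mathcomp Require Import all_classical all_reals all_analysis.
Require Import Defs.

Set Implicit Arguments.
Unset Strict Implicit.
Unset Printing Implicit Defensive.

Import Order.TTheory GRing.Theory Num.Theory.
Import numFieldNormedType.Exports.

Local Open Scope classical_set_scope.
Local Open Scope ring_scope.

(** Let G be Aut(F). The proof goes through a combinatorial condition on the
    topological group G, in which F no longer appears.

    A coloring chi of the copies of A, read as g |-> chi (g^-1 restricted to A),
    is a function f on G that is invariant under left translation by the
    pointwise stabilizer of A. By ultrahomogeneity every embedding of one finite
    substructure of F into another is the restriction of an automorphism, so
    the substructures D and E in the definition of a proximal coloring can be
    traded for finite sets Q and P of automorphisms: chi is proximal exactly
    when for every finite Q there is a finite P such that any two right
    translates of f by g1 and g2 agree on Qp for some p in P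
    ([syndetically_proximal]). Conversely, a function of finite range on G that
    is invariant under an open subgroup is a coloring. The proximal Ramsey
    property thus says that each proximal f of this kind is constant on some
    translate Qh of every finite set Q
    ([group_ramsey], [proximal_ramsey_group_ramsey]).

    From [group_ramsey] to fixed points. Let X be a proximal flow, x0 a point
    of X and phi a locally constant function on X. Then g |-> phi (g x0) is a
    proximal coloring: a pair of points can be brought together, and compactness
    of X * X lets finitely many elements do so for all pairs
    ([finite_proximal_orbit_function]). If X has no fixed point, compactness
    yields finitely many functions phi_i and elements g_i such that every z in X
    has some i for which phi_i (g_i z) is far from phi_i z. But a pair of
    proximal colorings is a proximal coloring, so a single h makes all the
    colorings g |-> phi_i (g x0) agree at g_i h and at h, and z = h x0 is a
    contradiction. It is enough here that the functions g |-> phi_i (g x0) be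
    uniformly approximated by proximal colorings
    ([fixed_point_of_finite_proximal_approximation]). In a zero-dimensional flow
    the indicators of clopen sets separate points. In an arbitrary flow
    continuous functions do, their orbit functions are proximal because the
    closure of their orbit is a factor of a subflow of X
    ([orbit_function_proximal]), and density provides the approximation.

    From fixed points to [group_ramsey]. If f is a proximal coloring, the
    closure of its orbit under right translation, for pointwise convergence, is
    a zero-dimensional proximal flow ([orbit_closure_flow]). A fixed point of it
    is a constant function, and f agrees with this constant on a translate of
    any given finite set. *)

(** * Proximal colorings as functions on the group *)

(** This is the condition on a coloring chi of the copies of A when f is
    g |-> chi (g^-1 restricted to A): the elements q^-1 of G, for q in Q, give
    copies of A inside D, and the elements p^-1, for p in P, give copies of D
    inside E. *)
Definition syndetically_proximal (G : groupType) (T : Type) (f : G -> T) :=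
  forall Q : set G, finite_set Q -> exists2 P : set G, finite_set P &
  forall g1 g2, exists2 p, P p &
    forall q, Q q -> f (q * p * g1)%g = f (q * p * g2)%g.

(** The second clause asks for one neighborhood that works for all g. In Aut(F)
    it says that f g only depends on the restriction of g^-1 to a finite set. *)
Definition finite_proximal (G : topologicalGroupType) (T : Type) (f : G -> T) :=
  [/\ finite_set (range f),
      exists2 U : set G, nbhs 1%g U & forall u g, U u -> f (u * g)%g = f g &
      syndetically_proximal f].

(** The translates Qh play the role of the copies of B, embedded by the
    restriction of h^-1. *)
Definition group_ramsey (C : Type) (G : topologicalGroupType) :=
  forall (f : G -> C) (Q : set G), finite_proximal f -> finite_set Q ->
  exists h, forall q, Q q -> f (q * h)%g = f h.

Section FiniteProximal.
Variable G : topologicalGroupType.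

Lemma finite_proximal_comp (T T' : Type) (k : T -> T') (f : G -> T) :
  finite_proximal f -> finite_proximal (k \o f).
Proof.
case=> fin [U nU Uf] sp; split.
- by rewrite -(image_comp f k); exact: finite_image.
- by exists U => // u g /(Uf u g) /= ->.
- move=> Q /sp[P fP PQ]; exists P => // g1 g2.
  by have [p Pp e] := PQ g1 g2; exists p => // q /e /= ->.
Qed.

Lemma finite_proximal_cst (T : Type) (c : T) : finite_proximal (fun _ : G => c).
Proof.
split=> [||Q _]; first exact: finite_image_cst.
- by exists setT => //; exact: filterT.
- by exists [set 1%g] => [|g1 g2]; [exact: finite_set1|exists 1%g].
Qed.

(** The witnesses are composed: P1 takes care of f1, and applying the hypothesis
    on f2 to the finite set Q P1 gives an r that makes f2 agree whichever p in
    P1 is then required by f1. *)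
Lemma syndetically_proximal_pair (T1 T2 : Type) (f1 : G -> T1) (f2 : G -> T2) :
  syndetically_proximal f1 -> syndetically_proximal f2 ->
  syndetically_proximal (fun g => (f1 g, f2 g)).
Proof.
move=> sp1 sp2 Q fQ; have [P1 fP1 e1] := sp1 Q fQ.
have [P2 fP2 e2] := sp2 [set (q * p)%g | q in Q & p in P1]
  (finite_image2 _ fQ fP1).
exists [set (p * r)%g | p in P1 & r in P2]; first exact: finite_image2.
move=> g1 g2; have [r Pr er] := e2 g1 g2.
have [p Pp ep] := e1 (r * g1)%g (r * g2)%g.
exists (p * r)%g; first by exists p => //; exists r.
move=> q Qq; congr pair.
  by have := ep q Qq; rewrite !mulgA.
by rewrite !mulgA; apply: er; exists q => //; exists p.
Qed.

Lemma finite_proximal_pair (T1 T2 : Type) (f1 : G -> T1) (f2 : G -> T2) :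
  finite_proximal f1 -> finite_proximal f2 ->
  finite_proximal (fun g => (f1 g, f2 g)).
Proof.
case=> fin1 [U1 nU1 e1] sp1 [fin2 [U2 nU2 e2] sp2]; split.
- by apply: sub_finite_set (finite_setX fin1 fin2) => _ [g _ <-]; split; exists g.
- by exists (U1 `&` U2) => [|u g [/e1-> /e2->]]//; exact: filterI.
- exact: syndetically_proximal_pair.
Qed.

Lemma finite_set_coding (T : Type) (C : numDomainType) (S : set T) :
  finite_set S -> exists k : T -> C, {in S &, injective k}.
Proof.
move=> /finite_set_countable/pcard_injP[k kinj].
exists (fun t => (k t)%:R) => x y xS yS /eqP.
by rewrite eqr_nat => /eqP; apply: kinj.
Qed.

(** Finitely many proximal colorings are refined by a single one with values
    again in C. The list of their values has a finite range, which is coded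
    injectively into C at each step. *)
Lemma finite_proximal_merge (C : numDomainType) (I : eqType) (s : seq I)
    (c : I -> G -> C) : (forall i, finite_proximal (c i)) ->
  exists2 f : G -> C, finite_proximal f &
    forall g h, f g = f h -> forall i, i \in s -> c i g = c i h.
Proof.
move=> cC; elim: s => [|i s [f fC ef]].
  by exists (fun=> 0) => //; exact: finite_proximal_cst.
have pC := finite_proximal_pair (cC i) fC; have [fin _ _] := pC.
have [k kinj] := finite_set_coding C fin.
exists (k \o (fun g => (c i g, f g))); first exact: finite_proximal_comp.
have in_range g : (c i g, f g) \in range (fun g => (c i g, f g)).
  by apply/mem_set; exists g.
move=> g h /= /kinj -/(_ (in_range g) (in_range h))[ei /ef es] j.
by rewrite inE => /predU1P[->//|/es].
Qed.

End FiniteProximal.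

(** * Embeddings between finite substructures *)

Lemma finite_family (X I T : Type) (ev : X -> I -> T) (S : set I) (V : set T) :
  finite_set S -> finite_set V -> (forall x i, S i -> V (ev x i)) ->
  (forall x y, (forall i, S i -> ev x i = ev y i) -> x = y) ->
  finite_set [set: X].
Proof.
elim/Pchoice: I => I in ev S *.
move=> /finite_seqP[s ->] fV evV ev_inj.
have fin_s (r : seq I) : {subset r <= s} ->
    finite_set (range (fun x => map (ev x) r)).
  elim: r => [|i r IH] rs; first exact: finite_image_cst.
  have rs' : {subset r <= s} by move=> j jr; apply: rs; rewrite inE jr orbT.
  have := finite_image2 cons fV (IH rs').
  apply: sub_finite_set => _ [x _ <-] /=; exists (ev x i).
    by apply: evV; apply: rs; rewrite mem_head.
  by exists (map (ev x) r) => //; exists x.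
have : finite_set ((fun x => map (ev x) s) @^-1`
    range (fun x => map (ev x) s)).
  apply: finite_preimage (fin_s s _) => // x y _ _ /eq_in_map xy.
  by apply: ev_inj => i; exact: xy.
by apply: sub_finite_set => x _; exists x.
Qed.

Section Embeddings.
Variable L : language.

Lemma corestrict (M N : structure L) (S : set N) (S0 : S !=set0)
    (e : embedding M N) : (forall x, S (e x)) ->
  exists e' : embedding M (substructure S0), forall x, incl S0 (e' x) = e x.
Proof.
move=> Se; pose f x : substructure S0 := exist _ (e x) (mem_set (Se x)).
have f_inj : injective f by move=> x y [/emb_inj].
suff f_rel r (t : (arity r).-tuple M) :
    rel_of (map_tuple f t) <-> rel_of t by exists (Embedding f_inj f_rel).
rewrite -(emb_rel e) /= (_ : map_tuple _ _ = map_tuple e t)//.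
by apply: val_inj; rewrite /= -map_comp.
Qed.

Lemma incl_inj (M : structure L) (S : set M) (S0 : S !=set0) :
  injective (incl S0).
Proof. exact: val_inj. Qed.

Lemma incl_mem (M : structure L) (S : set M) (S0 : S !=set0) x :
  S (incl S0 x).
Proof. exact: set_valP. Qed.

Variable F : structure L.

Lemma finite_age_carrier (D : age F) : finite_set [set: D].
Proof.
have : finite_set (set_val @^-1` age_set D : set (set_type (age_set D))).
  by apply: finite_preimage (age_finite D) => x y _ _ /val_inj.
by apply: sub_finite_set => x _; exact: set_valP.
Qed.

Lemma finite_embeddings (A D : age F) : finite_set [set: embedding A D].
Proof.
apply: (@finite_family _ _ _ (fun e : embedding A D => e) setT setT) => //.
- exact: finite_age_carrier.
- exact: finite_age_carrier.
- by move=> e1 e2 e; apply: embP => x; exact: e.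
Qed.

Lemma age_inclP (D : age F) x : age_set D x -> exists y, age_incl D y = x.
Proof. by move=> Dx; exists (exist _ x (mem_set Dx)). Qed.

Hypothesis homF : ultrahomogeneous F.

(** Ultrahomogeneity is about bijections between finite substructures of F, so
    e is first viewed as a bijection from D onto its image. The automorphism is
    named by its inverse because it acts on colorings through the inverse. *)
Lemma extend_embedding (D : age F) (e : embedding D F) :
  exists g : Aut F, forall x, (g^-1)%g (age_incl D x) = e x.
Proof.
have fin : finite_set (range e) by apply: finite_image; exact: finite_age_carrier.
pose B := Age fin (range_nonempty e).
have [|i ie] := @corestrict D F (range e) (range_nonempty e) e.
  by move=> x; exists x.
have i_bij : bijective i.
  rewrite -setTT_bijective; split => //; first by move=> x y _ _ /emb_inj.
  move=> y _; have [x _ xy] : range e (incl (range_nonempty e) y).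
    exact: incl_mem.
  by exists x => //; apply: (@incl_inj _ _ (range_nonempty e)); rewrite ie.
have [g gi] := homF (i_bij : bijective (i : embedding D B)).
by exists (g^-1)%g => x; rewrite invgK gi; exact: ie.
Qed.

End Embeddings.

(** * The proximal Ramsey property as a property of the group *)

Section Dictionary.
Variables (R : realType) (L : language) (F : structure L).
Hypothesis homF : ultrahomogeneous F.
Local Notation C := (Complex R).
Implicit Types (A B D E : age F) (g h : Aut F).

Lemma age_translates A (Q : set (Aut F)) : finite_set Q ->
  exists D, forall q x, Q q -> age_set A x -> age_set D ((q^-1)%g x).
Proof.
move=> fQ; pose S := [set (q^-1)%g x | q in Q & x in age_set A].
have fS : finite_set (age_set A `|` S).
  by rewrite finite_setU; split; [|apply: finite_image2 => //]; exact: age_finite.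
have S0 : age_set A `|` S !=set0 by have [x Ax] := age_nonempty A; exists x; left.
by exists (Age fS S0) => q x Qq Ax; right; exists q => //; exists x.
Qed.

Lemma aut_restrict g D E : (forall x, age_set D x -> age_set E (g x)) ->
  exists d : embedding D E, forall x, age_incl E (d x) = g (age_incl D x).
Proof.
move=> DE; have [|d dE] := @corestrict _ _ _ (age_set E) (age_nonempty E)
  (emb_comp g (age_incl D)); last by exists d.
by move=> x; apply: DE; exact: incl_mem.
Qed.

Lemma coloring_funE A (chi : coloring R A) (e : embedding A F) g :
  (forall x, (g^-1)%g (age_incl A x) = e x) -> coloring_fun chi g = chi e.
Proof. by move=> ge; congr chi; apply: embP => x; exact: ge. Qed.

Lemma embedding_to_copy (M N P : structure L) (d : embedding N P)
    (a : embedding M N) :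
  exists a' : embedding M (copy d), forall x, copy_incl d (a' x) = d (a x).
Proof.
by apply: (@corestrict _ _ _ _ (range_nonempty d) (emb_comp d a)) => x; exists (a x).
Qed.

Lemma embedding_from_copy (M N P : structure L) (d : embedding N P)
    (a : embedding M (copy d)) :
  exists a0 : embedding M N, forall x, copy_incl d (a x) = d (a0 x).
Proof.
have /choice[i di] : forall y : copy d, exists x, d x = copy_incl d y.
  move=> y; have [x _ xy] : range d (copy_incl d y) by exact: incl_mem.
  by exists x.
have ia_inj : injective (i \o a).
  move=> x y /= /(congr1 d); rewrite !di => /incl_inj; exact: emb_inj.
suff ia_rel r (t : (arity r).-tuple M) :
    rel_of (map_tuple (i \o a) t) <-> rel_of t.
  by exists (Embedding ia_inj ia_rel) => x /=; rewrite di.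
rewrite -(emb_rel d) -(emb_rel a) -(emb_rel (copy_incl d)).
suff -> : map_tuple d (map_tuple (i \o a) t) =
  map_tuple (copy_incl d) (map_tuple a t) by [].
apply: val_inj; rewrite /= -!map_comp; apply: eq_map => x /=; exact: di.
Qed.

Lemma coloring_fun_locally_constant A (chi : coloring R A) :
  exists2 U : set (Aut F), nbhs (1%g : Aut F) U &
    forall u g, U u -> coloring_fun chi (u * g)%g = coloring_fun chi g.
Proof.
exists [set u : Aut F | {in age_set A, u =1 (1%g : Aut F)}].
  by exists (age_set A) => //; exact: age_finite.
move=> u g uA; apply: coloring_funE => x; rewrite invgM /=; congr (aut_inv g _).
by apply: (canLR (autK u)); rewrite uA// mem_set//; exact: incl_mem.
Qed.

(** Q determines the finite substructure D that contains q^-1(A) for q in Q. If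
    E is given by proximality of chi for D, then P consists of one automorphism
    p for each embedding of D into E, where p^-1 extends that embedding. *)
Lemma finite_proximal_coloring_fun A (chi : coloring R A) :
  finite_coloring chi -> proximal_coloring chi ->
  finite_proximal (coloring_fun chi).
Proof.
move=> fin prox; split; last 1 first.
- move=> Q fQ; have [D QD] := age_translates A fQ; have [E DE] := prox D.
  have /choice[p pd] : forall d : embedding D E, exists g : Aut F,
      forall x, (g^-1)%g (age_incl D x) = age_incl E (d x).
    by move=> d; exact: (extend_embedding homF (emb_comp (age_incl E) d)).
  exists (range p); first exact/finite_image/finite_embeddings.
  move=> g1 g2; have [d dE] := DE (emb_comp (g1^-1)%g (age_incl E))
    (emb_comp (g2^-1)%g (age_incl E)).
  exists (p d); first by exists d.
  move=> q Qq.
  have [a aE] := aut_restrict (fun x (Ax : age_set A x) => QD q x Qq Ax).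
  have [a' a'E] := embedding_to_copy d a.
  have main g : coloring_fun chi (q * p d * g)%g = chi
      (emb_comp (emb_comp (g^-1)%g (age_incl E)) (emb_comp (copy_incl d) a')).
    apply: coloring_funE => x; rewrite !invgM /=; congr (aut_inv g _).
    by have := pd d (a x); rewrite aE -a'E.
  by rewrite !main.
- by apply: sub_finite_set fin => _ [g _ <-]; exact: imageT.
- exact: coloring_fun_locally_constant.
Qed.

(** The function f descends to embeddings of A as soon as A contains a finite
    set whose pointwise stabilizer leaves f invariant: two automorphisms with
    inverses that agree on A differ by an element of this stabilizer. For
    proximality, Q has one automorphism for each embedding of A into D, and E is
    a finite substructure that contains p^-1(D) for p in P. *)
Lemma coloring_of_finite_proximal (f : Aut F -> C) : finite_proximal f ->
  exists A (chi : coloring R A), [/\ finite_coloring chi, proximal_coloring chi &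
    f = coloring_fun chi].
Proof.
case=> fin [U [A0 fA0 A0U] Uf] sp.
have [x0 _] := structure_nonempty F.
(* The point x0 only serves to make the substructure nonempty. *)
have fA : finite_set (x0 |` A0) by rewrite finite_setU; split.
have A0' : x0 |` A0 !=set0 by exists x0; left.
pose A := Age fA A0'.
have /choice[s sE] := extend_embedding homF (D := A).
pose chi : coloring R A := f \o s.
have fchi : f = coloring_fun chi.
  apply/funext => g; rewrite /coloring_fun /chi /=.
  set h := s _; rewrite -{1}(mulgVK h g); apply/Uf/A0U => x x_in /=.
  have Ax : age_set A x by right; exact: set_mem.
  have [y yx] := age_inclP Ax.
  by have := sE _ y : (h^-1)%g _ = _; rewrite yx /= => ->; rewrite autVK.
exists A, chi; split => //.
  by apply: sub_finite_set fin => _ [e _ <-]; exact: imageT.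
move=> D; have /choice[q qE] : forall a : embedding A D, exists g : Aut F,
    forall x, (g^-1)%g (age_incl A x) = age_incl D (a x).
  by move=> a; exact: (extend_embedding homF (emb_comp (age_incl D) a)).
have [P fP PQ] := sp (range q) (finite_image _ (finite_embeddings A D)).
have [E PE] := age_translates D fP; exists E => e1 e2.
have [g1 g1E] := extend_embedding homF e1.
have [g2 g2E] := extend_embedding homF e2.
have [p Pp pq] := PQ g1 g2.
have [d dE] := aut_restrict (fun x (Dx : age_set D x) => PE p x Pp Dx).
exists d => a; have [a0 a0E] := embedding_from_copy a.
have main (e : embedding E F) g : (forall x, (g^-1)%g (age_incl E x) = e x) ->
    chi (emb_comp e (emb_comp (copy_incl d) a)) = f (q a0 * p * g)%g.
  move=> ge; rewrite fchi; symmetry; apply: coloring_funE => x.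
  by rewrite [RHS](_ : _ = e (copy_incl d (a x)))// -ge a0E dE -qE !invgM.
by rewrite (main _ _ g1E) (main _ _ g2E); apply: pq; exists a0.
Qed.

Lemma proximal_ramsey_group_ramsey :
  proximal_ramsey_property R F <-> group_ramsey C (Aut F).
Proof.
split=> [ramsey f Q /coloring_of_finite_proximal[A [chi [fin prox ->]]] fQ|].
  have [|B QB] := @age_translates A (1%g |` Q); first by rewrite finite_setU; split.
  have [b bE] := ramsey A B chi fin prox.
  have [h hb] := extend_embedding homF b.
  exists h => q Qq.
  have main g : (1%g |` Q) g -> exists a : embedding A (copy b),
      coloring_fun chi (g * h)%g = chi (emb_comp (copy_incl b) a).
    move=> Qg.
    have [a aE] := aut_restrict (fun x (Ax : age_set A x) => QB g x Qg Ax).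
    have [a' a'E] := embedding_to_copy b a; exists a'; apply: coloring_funE => x.
    by have := hb (a x); rewrite aE -a'E invgM.
  have [a1 ->] := main q (or_intror Qq).
  by have [a2] := main 1%g (or_introl erefl); rewrite mul1g => ->; exact: bE.
move=> ramsey A B chi fin prox.
have /choice[q qE] : forall a : embedding A B, exists g : Aut F,
    forall x, (g^-1)%g (age_incl A x) = age_incl B (a x).
  by move=> a; exact: (extend_embedding homF (emb_comp (age_incl B) a)).
have [h hq] := ramsey _ (range q) (finite_proximal_coloring_fun fin prox)
  (finite_image _ (finite_embeddings A B)).
exists (emb_comp (h^-1)%g (age_incl B)).
suff main a : chi (emb_comp (copy_incl (emb_comp (h^-1)%g (age_incl B))) a) =
    coloring_fun chi h by move=> a1 a2; rewrite !main.
have [a0 a0E] := embedding_from_copy a.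
rewrite -(hq (q a0)); last by exists a0.
symmetry; apply: coloring_funE => x.
rewrite [RHS](_ : _ = (h^-1)%g (age_incl B (a0 x))); last exact: a0E.
by rewrite -qE invgM.
Qed.

End Dictionary.

(** * Compactness *)

Section Compactness.

Lemma filter_finite_bigcap (T I : Type) (F : set_system T) (Q : set I)
    (P : I -> T -> Prop) : Filter F -> finite_set Q ->
  (forall i, Q i -> \forall x \near F, P i x) ->
  \forall x \near F, forall i, Q i -> P i x.
Proof.
elim/Pchoice: I => I in Q P *.
move=> FF /finite_fsetP[D ->] FP.
have := @filter_bigI T I D P F FF FP.
by apply: filterS => x DP i Di; exact: DP.
Qed.

(** Near-covering compactness is applied along the filter of the sets of indices
    that contain a large enough finite set: the indices i with x' in U i for x'
    near x only have to include the one chosen for x. *)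
Lemma compact_finite_subcover (X : topologicalType) (I : Type)
    (U : I -> set X) :
  compact [set: X] -> (forall x : X, exists i, nbhs x (U i)) ->
  exists2 D : set I, finite_set D & forall x, exists2 i, D i & U i x.
Proof.
move=> /compact_near_coveringP cX Ux.
pose above := filter_from (@finite_set I) (fun D => [set D' | D `<=` D']).
have above_filter : Filter above.
  apply: filter_from_filter; first by exists set0.
  move=> D E fD fE; exists (D `|` E); first by rewrite finite_setU.
  by move=> D' /= DE; split=> i ?; apply: DE; [left|right].
have [x _|D fD DU] := cX _ above (fun D x => exists2 i, D i & U i x) _.
  have [i Ui] := Ux x.
  exists (U i, [set D | D i]) => /=; last by move=> [y D] [/= Uy Di]; exists i.
  by split=> //; exists [set i] => // D; exact.
by exists D => // x; exact: (DU D).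
Qed.

(** Near x, a pair (x', y) that is close enough has both entries in a set A * B
    contained in W. Compactness makes the degree of closeness the same for
    all x. *)
Lemma compact_diagonal_entourage (X : uniformType) (W : set (X * X)) :
  [set: X] !=set0 -> compact [set: X] -> (forall x : X, nbhs (x, x) W) ->
  entourage W.
Proof.
move=> [x0 _] /compact_near_coveringP cX Wx.
have pf : ProperFilter (@entourage X).
  by apply: Build_ProperFilter_ex => E entE; exists (x0, x0); exact: entourage_refl.
have [x _|S [Sent Sdown [V SV]] SW] := cX _ (powerset_filter_from entourage)
    (fun V x => forall y, V (x, y) -> W (x, y))
    (@powerset_filter_from_filter _ _ pf).
  have [[A B] /= [nA nB] ABW] := Wx x.
  have : nbhs x (A `&` B) by exact: filterI.
  rewrite -nbhs_entourageE => -[E entE EAB].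
  have entE' := entourage_split_ent entE.
  exists (xsection (split_ent E) x, [set V | V `<=` split_ent E]) => /=.
    split; first exact: nbhs_entourage.
    apply/near_powerset_filter_fromP; first by move=> ? ?; exact: subset_trans.
    by exists (split_ent E).
  move=> [y V] [/= /xsectionP xy VE] z yz; apply: ABW; split => /=.
    have [] // : (A `&` B) y; apply/EAB/xsectionP.
    by apply: (entourage_split y) => //; exact: entourage_refl.
  by have [] // : (A `&` B) z; apply/EAB/xsectionP/(entourage_split y); last exact: VE.
by apply: filterS (Sent _ SV) => -[x y]; exact: (SW V SV x).
Qed.

End Compactness.

(** * Proximal colorings from proximal flows, and fixed points *)

Section Flows.
Variables (G : topologicalGroupType) (X : flow G).

Lemma flow_act_continuous g : continuous (@flow_act G X g).
Proof.
move=> x U /(@flow_continuous G X (g, x))[[A B] /= [nA nB] ABU].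
apply: filterS nB => y By; apply: (ABU (g, y)); split => //=.
exact: nbhs_singleton.
Qed.

(** Compactness of X makes the continuity of the action at the identity uniform
    in the point; hence the right uniform continuity of orbit functions. *)
Lemma flow_near_identity (W : set (X * X)) : (forall x : X, nbhs (x, x) W) ->
  \forall u \near (1%g : G), forall x, W (flow_act u x, x).
Proof.
move=> Wx; have /compact_near_coveringP cX := @flow_compact G X.
apply: (@filterS _ _ _ [set u | [set: X] `<=` (fun x => W (flow_act u x, x))]).
  by move=> u Wu x; exact: Wu.
apply: cX => x _.
have [[A B] /= [nA nB] ABW] := Wx x.
have /= := @flow_continuous G X (1%g, x) A; rewrite flow_act1.
move=> /(_ nA)[[U V] /= [nU nV] UVA].
exists (V `&` B, U) => /=; first by split=> //; exact: filterI.
by move=> [y u] /= [[Vy By] Uu]; apply: ABW; split=> //; exact: (UVA (u, y)).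
Qed.

(** The pairs (y, z) that are indistinguishable by phi under each q in Q form an
    entourage W. By proximality each pair of points is sent into W by some p,
    and so are the neighboring pairs, since phi is locally constant; by
    compactness of X * X finitely many p are enough. *)
Lemma finite_proximal_orbit_function (T : Type) (phi : X -> T) (x0 : X) :
  proximal_flow X -> (forall x : X, \forall y \near x, phi y = phi x) ->
  finite_proximal (fun g => phi (flow_act g x0)).
Proof.
move=> prox lc; have lcW (x : X) : nbhs (x, x) [set p | phi p.1 = phi p.2].
  by exists ([set y | phi y = phi x], [set y | phi y = phi x]);
    [split; exact: lc|move=> [y z] /= [-> ->]].
split.
- have [x|D fD Dphi] := compact_finite_subcover
    (U := fun y => [set x | phi x = phi y]) (@flow_compact G X).
    by exists x; exact: lc.
  apply: sub_finite_set (finite_image phi fD) => _ [g _ <-].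
  by have [y Dy /= ->] := Dphi (flow_act g x0); exists y.
- exists [set u : G | forall x : X, phi (flow_act u x) = phi x].
    exact: flow_near_identity lcW.
  by move=> u g uphi; rewrite flow_actM; exact: uphi.
move=> Q fQ.
pose W := [set p : X * X | forall q, Q q ->
  phi (flow_act q p.1) = phi (flow_act q p.2)].
pose alike x := [set y | forall q, Q q ->
  phi (flow_act q y) = phi (flow_act q x)].
have near_alike x : nbhs x (alike x).
  apply: filter_finite_bigcap => // q _.
  exact: (flow_act_continuous (lc (flow_act q x))).
have entW : entourage W.
  apply: compact_diagonal_entourage.
  - exact: flow_nonempty.
  - exact: flow_compact.
  - move=> x; exists (alike x, alike x) => // -[y z] /= [xy xz] q Qq.
    by rewrite xy// xz.
have cXX : compact [set: X * X].
  by rewrite -setXTT; apply: compact_setX; exact: flow_compact.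
have [[x y]|P fP PW] := compact_finite_subcover
    (U := fun p => [set z : X * X | W (flow_act p z.1, flow_act p z.2)]) cXX.
  have [p Wp] := prox x y _ entW; exists p.
  exists (flow_act p @^-1` alike (flow_act p x),
          flow_act p @^-1` alike (flow_act p y)).
    by split; apply: flow_act_continuous; exact: near_alike.
  by move=> [x' y'] /= [xx' yy'] q Qq /=; rewrite xx'// yy'//; exact: Wp.
exists P => // g1 g2; have [p Pp Wp] := PW (flow_act g1 x0, flow_act g2 x0).
by exists p => // q Qq; rewrite -!mulgA !flow_actM; exact: Wp.
Qed.

(** If every y is moved by some element mv y, then a function phi y detects it,
    and it does so with a margin eps y on a whole neighborhood of y. Finitely
    many of these neighborhoods cover X. The Ramsey property for the merged
    approximations c y gives an h such that none of the corresponding functions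
    phi y detects that mv y moves h x0. *)
Lemma fixed_point_of_finite_proximal_approximation (C : numFieldType) (x0 : X) :
  group_ramsey C G ->
  (forall y z : X, y <> z -> exists phi : X -> C,
    [/\ continuous phi, phi y != phi z &
        forall eps : C, 0 < eps -> exists2 c : G -> C, finite_proximal c &
          forall g, `|phi (flow_act g x0) - c g| < eps]) ->
  has_fixed_point X.
Proof.
move=> ramsey sep; apply: contrapT => nofix.
have /choice[w wP] : forall y : X, exists w : (G * (X -> C)) * (G -> C),
    let: (g, phi, c) := w in
    let eps := `|phi (flow_act g y) - phi y| / 2 in
    [/\ continuous phi, 0 < eps, finite_proximal c &
        forall g, `|phi (flow_act g x0) - c g| < eps / 2].
  move=> y; have /existsNP[g /sep[phi [cphi ne app]]] :
      ~ forall g, flow_act g y = y by move=> fixy; apply: nofix; exists y.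
  have eps_gt0 : 0 < `|phi (flow_act g y) - phi y| / 2.
    by rewrite divr_gt0// normr_gt0 subr_eq0.
  have [c cl capp] := app _ (divr_gt0 eps_gt0 (ltr0n _ 2)).
  by exists (g, phi, c).
(* The group element mv y moves y, and disp y measures the displacement of a
   point under mv y as seen by phi y. *)
pose mv y := (w y).1.1; pose phi y := (w y).1.2; pose c y := (w y).2.
pose disp y z := phi y (flow_act (mv y) z) - phi y z.
pose eps y := `|disp y y| / 2.
have wE y : [/\ continuous (phi y), 0 < eps y, finite_proximal (c y) &
    forall g, `|phi y (flow_act g x0) - c y g| < eps y / 2].
  by have := wP y; rewrite /eps /disp /phi /mv /c; case: (w y) => [[? ?] ?].
have [y|D fD Dfar] := compact_finite_subcover
    (U := fun y => [set z | ~ `|disp y z| < eps y]) (@flow_compact G X).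
  exists y; have [cphi eps_gt0 _ _] := wE y.
  have cdisp : continuous (disp y).
    move=> z; apply: cvgB; last exact: cphi.
    apply: (@continuous_comp _ _ _ (flow_act (mv y)) (phi y)); last exact: cphi.
    exact: flow_act_continuous.
  have /cvgrPdist_lt/(_ _ eps_gt0) := cdisp y.
  apply: filterS => z near_y small.
  have : `|disp y y| < `|disp y y|.
    rewrite -{1}(subrK (disp y z) (disp y y)) (le_lt_trans (ler_normD _ _))//.
    by rewrite [ltRHS]splitr ltrD.
  by rewrite ltxx.
have /finite_seqP[s sD] := fD.
have [f fcl fc] := finite_proximal_merge s (fun y => let: And4 _ _ h _ := wE y in h).
have [h hf] := ramsey f _ fcl (finite_image mv fD).
have [y Dy] := Dfar (flow_act h x0); apply.
have [_ _ _ app] := wE y.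
have cE : c y (mv y * h)%g = c y h.
  by apply: fc; [apply: hf; exists y|rewrite sD in Dy].
rewrite /disp -flow_actM.
rewrite -(subrKA (c y (mv y * h)%g)) (le_lt_trans (ler_normD _ _))//.
by rewrite [ltRHS]splitr ltrD// cE distrC.
Qed.

End Flows.

(** * The orbit closure of a proximal coloring *)

Lemma mulgl_continuous (G : topologicalGroupType) (a : G) :
  continuous (fun g : G => a * g)%g.
Proof.
move=> g U /(@mulg_continuous G (a, g))[[A B] /= [nA nB] ABU].
apply: filterS nB => h Bh; apply: (ABU (a, h)); split => //=.
exact: nbhs_singleton.
Qed.

Lemma mulgr_continuous (G : topologicalGroupType) (a : G) :
  continuous (fun g : G => g * a)%g.
Proof.
move=> g U /(@mulg_continuous G (g, a))[[A B] /= [nA nB] ABU].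
apply: filterS nA => h Ah; apply: (ABU (h, a)); split => //=.
exact: nbhs_singleton.
Qed.

(** A basic entourage of the product uniformity constrains finitely many
    coordinates, hence contains the pairs that are equal on these. *)
Lemma ptws_entourage_finite (I : choiceType) (T : uniformType)
    (W : set ({ptws I -> T} * {ptws I -> T})) : entourage W ->
  exists2 Q : set I, finite_set Q &
    forall u v : {ptws I -> T}, (forall i, Q i -> u i = v i) -> W (u, v).
Proof.
move=> [_ [D _ <-] DW].
apply: (ex_intro2 _ _ _ (finite_image (fun ie => (sval ie).1) (finite_fset D))).
move=> u v uv; apply: DW => -[[i E] /= entE] Di.
have /asboolP[V entV VE] := entE.
have uvi : u i = v i by apply: uv; exists (exist _ (i, E) entE).
by apply: VE; rewrite /unstable.map_pair /= /proj uvi; exact: entourage_refl.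
Qed.

Section OrbitClosureFlow.
Variables (R : realType) (G : topologicalGroupType).
Local Notation C := (Complex R).
Variables (f : G -> C).
Local Notation S := (orbit_closure f).

Lemma evaluation_continuous k : continuous (fun u : S => (val u : G -> C) k).
Proof.
move=> u; apply: (@continuous_comp _ _ _ (set_val : S -> {ptws G -> C})
  (fun v : {ptws G -> C} => v k)); first exact: initial_continuous.
exact: (@proj_continuous G (fun _ => C) k).
Qed.

Lemma cvg_orbit_closure (T : Type) (F : set_system T) (s : T -> S) (u : S) :
  Filter F -> (forall k, (val (s t) : G -> C) k @[t --> F] --> (val u : G -> C) k) ->
  s @ F --> u.
Proof.
move=> FF cvgk.
have cvgS : (fun t => val (s t) : {ptws G -> C}) @ F --> (val u : {ptws G -> C}).
  apply/cvg_sup => k A [_ [[B oB <-] Bu] BA].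
  have /cvgk : nbhs ((val u : G -> C) k) B by exact: open_nbhs_nbhs.
  by apply: (@filterS _ F FF) => t Bt; exact: BA.
move=> A [_ [[B oB <-] Bu] BA].
have /cvgS : nbhs (val u : {ptws G -> C}) B by exact: open_nbhs_nbhs.
by apply: (@filterS _ F FF) => t Bt; exact: BA.
Qed.

Lemma mem_orbit_closure : S f.
Proof.
apply: subset_closure; exists 1%g => //.
by apply/funext => h; rewrite /translate mulg1.
Qed.

Lemma orbit_closure_hausdorff : hausdorff_space S.
Proof.
move=> u v uv; apply: val_inj.
have hC : hausdorff_space {ptws G -> C}.
  by apply: (@hausdorff_product G (fun _ => C)) => _; exact: norm_hausdorff.
apply: hC => A B nA nB; have cval := @initial_continuous S {ptws G -> C} set_val.
have [z [Az Bz]] := uv _ _ (cval u A nA) (cval v B nB).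
by exists (val z).
Qed.

Hypothesis fin : finite_set (range f).

Lemma closed_finite_colors (K : set C) : finite_set K -> closed K.
Proof.
apply: (@accessible_finite_set_closed C).1.
exact/hausdorff_accessible/norm_hausdorff.
Qed.

(** As f takes finitely many values, these are isolated from each other, and
    pointwise approximation on a finite set becomes equality. This is how facts
    about f pass to its orbit closure. *)
Lemma orbit_closure_agree (u : S) (Q : set G) : finite_set Q ->
  exists h, forall k, Q k -> (val u : G -> C) k = f (k * h)%g.
Proof.
move=> fQ; have Su : S (val u) := set_mem (valP u).
have near_u : \forall v \near (val u : {ptws G -> C}), forall k, Q k ->
    (~` (range f `\ (val u : G -> C) k)) ((v : G -> C) k).
  have nF : Filter (nbhs (val u : {ptws G -> C})) by exact: nbhs_filter.
  apply: (filter_finite_bigcap nF fQ) => k Qk.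
  apply: (@proj_continuous G (fun _ => C) k (val u)).
  apply: open_nbhs_nbhs; split; last by move=> [_]; apply.
  by rewrite openC; apply: closed_finite_colors; exact: finite_setD.
have [v [[h _ <-] vu]] := Su _ near_u; exists h => k Qk.
apply: contrapT => ne; apply: (vu k Qk); split; first by exists (k * h)%g.
by move=> /esym.
Qed.

Lemma orbit_closure_range (u : S) k : range f ((val u : G -> C) k).
Proof.
have [h hk] := orbit_closure_agree u (finite_set1 k).
by exists (k * h)%g => //; rewrite hk.
Qed.

(** By Tychonoff, as the elements of the orbit closure take their values in the
    finite range of f. *)
Lemma orbit_closure_compact : compact [set: S].
Proof.
have : compact (S : set {ptws G -> C}).
  apply: (@subclosed_compact _ _ [set v : {ptws G -> C} | forall k, range f (v k)]).
  - exact: closed_closure.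
  - by apply: (@tychonoff G (fun _ => C) (fun _ => range f)) => _; exact: finite_compact.
  - move=> v Sv k.
    exact: (orbit_closure_range (exist _ v (mem_set Sv))).
move=> cS F PF _.
have PF' : ProperFilter ((val : S -> {ptws G -> C}) @ F) by exact: fmap_proper_filter.
have [|u [Su clu]] := cS _ PF'.
  by apply: (@filterS _ F _ setT) => [v _|]; [have := set_mem (valP v)|exact: filterT].
exists (exist _ u (mem_set Su)); split => // A B FA [_ [[V oV <-] Vu] VB].
have FA' : (val x @[x --> F]) ((val : S -> {ptws G -> C}) @` A).
  by apply: (@filterS _ F _ A) => // v Av; exists v.
have [_ [[v Av <-] Vv]] := clu _ V FA' (open_nbhs_nbhs (conj oV Vu)).
by exists v; split => //; exact: VB.
Qed.

(** Evaluations take finitely many values on the orbit closure, so that their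
    fibers are clopen; these separate points, and in a compact Hausdorff space
    clopen sets that separate points generate the topology. *)
Lemma orbit_closure_zero_dimensional : basis (@clopen S).
Proof.
have zd : zero_dimensional S.
  move=> u v /eqP uv.
  have /existsNP[k /eqP ne] : ~ forall k, (val u : G -> C) k = (val v : G -> C) k.
    by move=> e; apply: uv; apply: val_inj; exact/funext.
  pose ev (w : S) := (val w : G -> C) k.
  have cev : continuous ev := @evaluation_continuous k.
  exists (ev @^-1` [set ev u]); split=> //; last by move=> /esym/eqP; exact/negP.
  split; last first.
    apply: closed_comp => [w _|]; first exact: cev.
    by apply: closed_finite_colors; exact: finite_set1.
  have -> : ev @^-1` [set ev u] = ev @^-1` (~` (range f `\ ev u)).
    apply/seteqP; split=> w /=; first by move=> -> [].
    move=> nw; apply: contrapT => ne'; apply: nw; split => //.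
    exact: orbit_closure_range.
  apply: open_comp => [w _|]; first exact: cev.
  by rewrite openC; apply: closed_finite_colors; exact: finite_setD.
split=> [A [oA _]//|u A nA].
have := @zero_dimensional_cvg S u orbit_closure_hausdorff zd orbit_closure_compact.
by move=> /(_ A nA)[D [Du cD] DA]; exists D.
Qed.

Hypothesis loc : exists2 U : set G, nbhs (1%g : G) U &
  forall u g, U u -> f (u * g)%g = f g.

(** The invariance of f under U passes to its orbit closure. For h close to g,
    the element k h g^-1 k^-1 is in U, so that v (k h) = v (k g), which is
    continuous in v alone. *)
Lemma orbit_closure_act_continuous :
  continuous (fun p : G * S => orbit_closure_act p.1 p.2).
Proof.
have [U nU fU] := loc.
move=> [g u]; apply: cvg_orbit_closure => k A /= nA.
have nUg : \forall h \near g, U (k * h * (g^-1 * k^-1))%g.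
  apply: (@mulgl_continuous G k g [set h | U (h * (g^-1 * k^-1))%g]).
  apply: (@mulgr_continuous G (g^-1 * k^-1)%g (k * g)%g U).
  by rewrite mulgA mulgK mulgV.
exists ([set h | U (k * h * (g^-1 * k^-1))%g],
        [set v : S | A ((val v : G -> C) (k * g)%g)]).
  by split => //; exact: (@evaluation_continuous (k * g)%g u).
move=> [h v] /= [Uh Av]; rewrite /translate.
have [r ru] := orbit_closure_agree v (finite_set2 (k * h)%g (k * g)%g).
have -> : (val v : G -> C) (k * h)%g = (val v : G -> C) (k * g)%g; last exact: Av.
rewrite !ru; [|by right|by left].
rewrite -(fU _ (k * g * r)%g Uh); congr f.
by rewrite -!mulgA mulKg mulKg.
Qed.

Definition orbit_closure_flow : flow G.
Proof.
apply: (@Flow G S (@orbit_closure_act R G f)).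
- by exists (exist _ (f : {ptws G -> C}) (mem_set mem_orbit_closure)).
- exact: orbit_closure_compact.
- exact: orbit_closure_hausdorff.
- by move=> u; apply/val_inj/funext => h; rewrite /= /translate mulg1.
- by move=> g h u; apply/val_inj; rewrite /= translateM.
- exact: orbit_closure_act_continuous.
Defined.

Hypothesis sprox : syndetically_proximal f.

Lemma orbit_closure_proximal : proximal_action (@orbit_closure_act R G f).
Proof.
move=> u v W [W' /ptws_entourage_finite[Q fQ QW] W'W].
have [P fP PQ] := sprox fQ.
have fQP := finite_image2 (fun q p => (q * p)%g) fQ fP.
have [h1 u_h1] := orbit_closure_agree u fQP.
have [h2 v_h2] := orbit_closure_agree v fQP.
have [p Pp ep] := PQ h1 h2.
exists p; apply: W'W; apply: QW => q Qq.
have qp : [set (q * p)%g | q in Q & p in P] (q * p)%g by exists q => //; exists p.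
suff : (val u : G -> C) (q * p)%g = (val v : G -> C) (q * p)%g by [].
by rewrite u_h1// v_h2// ep.
Qed.

End OrbitClosureFlow.

(** A fixed point u of the orbit closure of f satisfies u (h g) = u h for all g
    and h, so u is constant. *)
Lemma zero_dimensional_group_ramsey (R : realType) (G : topologicalGroupType) :
  zero_dimensional_strongly_amenable G -> group_ramsey (Complex R) G.
Proof.
move=> zsa f Q [fin loc sprox] fQ.
have [u ufix] := zsa (orbit_closure_flow fin loc)
  (orbit_closure_zero_dimensional fin) (orbit_closure_proximal fin sprox).
have [|h hu] := orbit_closure_agree fin u (Q := 1%g |` Q).
  by rewrite finite_setU; split.
have ucst k : (val u : G -> Complex R) k = (val u : G -> Complex R) 1%g.
  have := congr1 (fun v : orbit_closure f => (val v : G -> Complex R) 1%g) (ufix k).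
  by rewrite /= /translate mul1g.
by exists h => q Qq; rewrite -hu ?ucst ?hu ?mul1g//; [left|right].
Qed.

(** * Orbit functions of continuous functions on a proximal flow *)

Section ComplexValues.
Variable R : realType.
Local Notation C := (Complex R).

Lemma real_complex_continuous :
  continuous (fun x : R => real_complex R x : C).
Proof.
move=> x; apply/cvgrPdist_lt => e; rewrite ltcE /= => /andP[/eqP im_e re_e].
have /cvgrPdist_lt/(_ _ re_e) : (fun y : R => y) @ x --> x by exact: cvg_id.
apply: filterS => y xy.
rewrite -rmorphB normc_def /= expr0n addr0 sqrtr_sqr ltcE /=.
by rewrite im_e eqxx.
Qed.

Lemma locally_constant_continuous (X : topologicalType) (phi : X -> C) :
  (forall x : X, \forall y \near x, phi y = phi x) -> continuous phi.
Proof.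
move=> lc x A nA; apply: filterS (lc x) => y /= ->; exact: nbhs_singleton.
Qed.

Lemma hausdorff_separating_function (X : uniformType) (y z : X) :
  hausdorff_space X -> y <> z ->
  exists2 phi : X -> C, continuous phi & phi y != phi z.
Proof.
move=> hX yz.
have zcl : closed [set z] by exact: accessible_closed_set1 (hausdorff_accessible hX) z.
have [h [ch _ h0 h1]] :=
  (@uniform_separatorP X R _ _).1 (@point_uniform_separator R _ _ _ zcl yz).
exists (fun x => real_complex R (h x)).
  move=> x; apply: (@continuous_comp _ _ _ h (fun x : R => real_complex R x : C)).
    exact: ch.
  exact: real_complex_continuous.
have -> : h y = 0 by apply: h0; exists y.
have -> : h z = 1 by apply: h1; exists z.
by rewrite rmorph0 rmorph1 eq_sym oner_neq0.
Qed.

End ComplexValues.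

Section OrbitFunctions.
Variables (R : realType) (G : topologicalGroupType) (X : flow G).
Local Notation C := (Complex R).
Variables (phi : X -> C) (x0 : X).
Hypothesis cphi : continuous phi.

Lemma orbit_function_RUCb : RUCb (fun g : G => phi (flow_act g x0)).
Proof.
split.
  have [x|D /finite_seqP[s ->] Dphi] := compact_finite_subcover
      (U := fun x => [set y | `|phi y| < `|phi x| + 1]) (@flow_compact G X).
    exists x; have /cvgrPdist_lt/(_ _ ltr01) := @cphi x.
    apply: filterS => y /=; rewrite distrC => xy.
    by rewrite -[X in `|X|](subrKC (phi x)) (le_lt_trans (ler_normD _ _))// ltrD2l.
  exists (\sum_(x <- s) (`|phi x| + 1)) => g.
  have [x /= xs /ltW phig] := Dphi (flow_act g x0); apply: le_trans phig _.
  by rewrite (big_rem x)//= lerDl sumr_ge0// => y _; rewrite addr_ge0.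
move=> e e0; pose W := [set p : X * X | `|phi p.1 - phi p.2| < e].
have Wx (x : X) : nbhs (x, x) W.
  have e20 : 0 < e / 2 by rewrite divr_gt0.
  have /cvgrPdist_lt/(_ _ e20) nx := @cphi x.
  exists ([set y | `|phi x - phi y| < e / 2], [set y | `|phi x - phi y| < e / 2]) => //.
  move=> [y z] [/= xy xz]; rewrite /W /= -(subrKA (phi x)).
  by rewrite (le_lt_trans (ler_normD _ _))// [ltRHS]splitr ltrD// distrC.
exists [set u | forall x : X, W (flow_act u x, x)]; first exact: flow_near_identity Wx.
move=> g h /(_ (flow_act h x0)); rewrite /W /= -flow_actM.
by rewrite -mulgA mulVg mulg1.
Qed.

Let orb (y : X) : {ptws G -> C} := fun g => phi (flow_act g y).

Lemma translate_orbit g y : translate g (orb y) = orb (flow_act g y).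
Proof. by apply/funext => h; rewrite /translate /orb flow_actM. Qed.

Lemma orbit_continuous : continuous orb.
Proof.
move=> y; have FF : Filter (orb @ y) by exact: fmap_filter.
apply/cvg_sup => g A [_ [[B oB <-] By] BA].
have : nbhs y ((fun z => phi (flow_act g z)) @^-1` B).
  apply: (@continuous_comp _ _ _ (flow_act g) phi y).
  - exact: flow_act_continuous.
  - exact: cphi.
  - exact: open_nbhs_nbhs.
by apply: filterS => z Bz; exact: BA.
Qed.

(** The map orb is a continuous and equivariant map from X to functions, so its
    range is a closed set that contains the orbit of orb x0. *)
Lemma orbit_closure_lift (u : {ptws G -> C}) :
  orbit_closure (fun g : G => phi (flow_act g x0)) u -> exists y, orb y = u.
Proof.
have cl : closed (range orb).
  apply: compact_closed.
    by apply: (@hausdorff_product G (fun _ => C)) => _; exact: norm_hausdorff.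
  apply: continuous_compact; last exact: flow_compact.
  exact/continuous_subspaceT/orbit_continuous.
move=> Su; have [] : range orb u; last by move=> y _ <-; exists y.
apply: cl; apply: closure_subset Su => _ [g _ <-].
by exists (flow_act g x0) => //; rewrite -translate_orbit.
Qed.

(** Proximality passes from X to the orbit closure: lift two elements to points
    of X, and use the preimage under orb of a given entourage, which is an
    entourage by compactness of X. *)
Lemma orbit_function_proximal : proximal_flow X ->
  proximal_function (fun g : G => phi (flow_act g x0)).
Proof.
move=> prox; split; first exact: orbit_function_RUCb.
move=> u v W [W' entW' W'W].
have [y yu] := orbit_closure_lift (set_mem (valP u)).
have [z zv] := orbit_closure_lift (set_mem (valP v)).
have entW : entourage [set p : X * X | W' (orb p.1, orb p.2)].
  apply: compact_diagonal_entourage; [exact: flow_nonempty|exact: flow_compact|].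
  move=> x; have entE := entourage_split_ent entW'.
  exists ([set y | (split_ent W')^-1%relation (orb x, orb y)],
          [set y | split_ent W' (orb x, orb y)]); last first.
    by move=> [a b] [/= xa xb]; exact: entourage_split entW' xa xb.
  split=> /=.
    have nx := orbit_continuous (nbhs_entourage (orb x) (entourage_inv entE)).
    by apply: (@filterS _ (nbhs x) _ _ _ _ nx) => a /xsectionP.
  have nx := orbit_continuous (nbhs_entourage (orb x) entE).
  by apply: (@filterS _ (nbhs x) _ _ _ _ nx) => a /xsectionP.
have [g] := prox y z _ entW; rewrite /= -!translate_orbit yu zv => Wg.
by exists g; exact: W'W.
Qed.

End OrbitFunctions.

(** * Fixed points and the Ramsey property *)

Section MainEquivalences.
Variables (R : realType).
Local Notation C := (Complex R).

(** The indicators of clopen sets are locally constant, so their orbit functions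
    are proximal colorings, and the approximation required by the fixed point
    criterion is an equality. *)
Lemma group_ramsey_zero_dimensional (G : topologicalGroupType) :
  group_ramsey C G -> zero_dimensional_strongly_amenable G.
Proof.
move=> ramsey X [_ zd] prox; have [x0 _] := @flow_nonempty G X.
apply: (@fixed_point_of_finite_proximal_approximation _ X C x0 ramsey) => y z /eqP yz.
have [A [oA /set_mem Ay /set_mem nAz]] :=
  hausdorff_accessible (@flow_hausdorff G X) yz.
have [U [[oU cU] Uy] UA] := zd y A (open_nbhs_nbhs (conj oA Ay)).
pose phi x : C := `[< U x >]%:R.
have lc (x : X) : \forall x' \near x, phi x' = phi x.
  have [Ux|nUx] := pselect (U x).
    have : nbhs x U by exact: open_nbhs_nbhs.
    by apply: filterS => x' Ux'; rewrite /phi (asboolT Ux) (asboolT Ux').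
  have : nbhs x (~` U) by apply: open_nbhs_nbhs; split => //; exact: closed_openC.
  by apply: filterS => x' nUx'; rewrite /phi (asboolF nUx) (asboolF nUx').
exists phi; split; first exact: locally_constant_continuous.
  rewrite /phi (asboolT Uy) asboolF ?oner_neq0//.
  by move=> /UA.
move=> e e0; exists (fun g => phi (flow_act g x0)).
  exact: finite_proximal_orbit_function.
by move=> g; rewrite subrr normr0.
Qed.

Lemma dense_colorings_strongly_amenable (L : language) (F : structure L) :
  ultrahomogeneous F -> proximal_colorings_dense R F ->
  group_ramsey C (Aut F) -> strongly_amenable (Aut F).
Proof.
move=> homF dense ramsey X prox; have [x0 _] := @flow_nonempty _ X.
apply: (@fixed_point_of_finite_proximal_approximation _ X C x0 ramsey) => y z yz.
have [phi cphi ne] := hausdorff_separating_function R (@flow_hausdorff _ X) yz.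
exists phi; split => // e e0.
have [A [chi [fin proxchi near_chi]]] :=
  dense _ (orbit_function_proximal x0 cphi prox) e e0.
by exists (coloring_fun chi) => //; exact: finite_proximal_coloring_fun.
Qed.

End MainEquivalences.

Theorem theorem6 (R : realType) (L : language) (F : structure L)
  (hF : fraisse_structure F) :
  (zero_dimensional_strongly_amenable (Aut F) <->
     proximal_ramsey_property R F) /\
  (proximal_colorings_dense R F ->
     (zero_dimensional_strongly_amenable (Aut F) <->
        strongly_amenable (Aut F)) /\
     (proximal_ramsey_property R F <-> strongly_amenable (Aut F))).
Proof.
have homF : ultrahomogeneous F by case: hF.
have ramseyP := proximal_ramsey_group_ramsey R homF.
have zsaP : zero_dimensional_strongly_amenable (Aut F) <->
    proximal_ramsey_property R F.
  rewrite ramseyP; split; first exact: zero_dimensional_group_ramsey.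
  exact: group_ramsey_zero_dimensional.
have sa_zsa : strongly_amenable (Aut F) ->
    zero_dimensional_strongly_amenable (Aut F) by move=> sa X _; exact: sa.
split=> // dense.
have sa : proximal_ramsey_property R F -> strongly_amenable (Aut F).
  by rewrite ramseyP; exact: dense_colorings_strongly_amenable.
rewrite zsaP; split; split=> //; rewrite -zsaP; exact: sa_zsa.
Qed.
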